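(* For each positive integer $n$, the set $\mathbf{S}^n_+$ of $n\times n$ real symmetric positive semidefinite matrices is a perfect cone in $\mathbf{S}^n$, the Hilbert space of $n\times n$ real symmetric matrices with inner product $\langle x,y\rangle=\mathrm{tr}(xy)$.
   Context: In a real Hilbert space $\mathcal{H}$, a cone is a subset $\mathcal{C}$ that is convex and contains the origin, i.e. $\alpha x+\beta y\in\mathcal{C}$ for all $x,y\in\mathcal{C}$ and $\alpha,\beta\ge 0$. It is pointed if $\mathcal{C}\cap(-\mathcal{C})=\{0\}$. Write $x\preceq y$ if $y-x\in\mathcal{C}$. $\overline{\mathrm{span}}$ denotes the closed linear span. The dual cone of a cone $\mathcal{K}$ is taken within its closed linear span: $\mathcal{K}^\vee=\{x\in\overline{\mathrm{span}}\,\mathcal{K}:\langle x,y\rangle\ge 0\ \forall y\in\mathcal{K}\}$. A face of a closed and pointed cone $\mathcal{C}$ is a subset $\mathcal{F}\subset\mathcal{C}$ which is a cone and satisfies: if $0\preceq x\preceq y$ and $y\in\mathcal{F}$, then $x\in\mathcal{F}$. A (closed and pointed) cone $\mathcal{C}$ is perfect if every face $\mathcal{F}$ of $\mathcal{C}$ satisfies: (1) $\mathcal{F}^\vee=\mathcal{F}$; (2) $\mathcal{F}$ has nonempty interior with respect to $\overline{\mathrm{span}}\,\mathcal{F}$. *)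

(* Defs.v *)
From HB Require Import structures.
From mathcomp Require Import all_boot all_order all_algebra.
From mathcomp Require Import all_classical all_reals all_analysis.
From mathcomp Require Import ring lra.

Set Implicit Arguments.
Unset Strict Implicit.
Unset Printing Implicit Defensive.
Import Order.TTheory GRing.Theory Num.Theory.
Import numFieldNormedType.Exports.
Local Open Scope classical_set_scope.
Local Open Scope ring_scope.

HB.mixin Record hasInner (R : realType) V & CompleteNormedModule R V := {
  inner : V -> V -> R;
  innerC : forall x y : V, inner x y = inner y x;
  innerDl : forall x y z : V, inner (x + y) z = inner x z + inner y z;
  innerZl : forall (a : R) (x y : V), inner (a *: x) y = a * inner x y;
  inner_normE : forall x : V, inner x x = `|x| ^+ 2
}.

#[short(type="hilbertType")]
HB.structure Definition Hilbert (R : realType) :=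
  {V of CompleteNormedModule R V & hasInner R V}.

Section Cones.
Context {R : realType} {H : hilbertType R}.
Implicit Types (A C F K : set H) (x y : H).

Definition cone C := C 0 /\
  forall (a b : R) x y, 0 <= a -> 0 <= b -> C x -> C y -> C (a *: x + b *: y).

Definition pointed_cone C := C `&` [set - x | x in C] = [set 0].

Definition cone_le C x y := C (y - x).

Definition linear_subspace A := A 0 /\
  forall (a b : R) x y, A x -> A y -> A (a *: x + b *: y).

Definition closed_span A : set H := closure (smallest linear_subspace A).

Definition dual_cone K : set H :=
  [set x | closed_span K x /\ forall y, K y -> 0 <= inner x y].

Definition face C F := [/\ F `<=` C, cone F &
  forall x y, cone_le C 0 x -> cone_le C x y -> F y -> F x].

(* In [subspace A] the points outside [A] are isolated; this is harmless here
   because [F] is contained in [closed_span F]. *)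
Definition relative_interior F : set H :=
  @interior (subspace (closed_span F)) F.

Definition perfect_cone C :=
  [/\ cone C, closed C, pointed_cone C &
      forall F, face C F -> dual_cone F = F /\ relative_interior F !=set0].

End Cones.

Section InnerProductNorm.
Context {R : realType} {V : lmodType R} (f : V -> V -> R).
Hypothesis fC : forall x y, f x y = f y x.
Hypothesis fDl : forall x y z, f (x + y) z = f x z + f y z.
Hypothesis fZl : forall a x y, f (a *: x) y = a * f x y.
Hypothesis f_ge0 : forall x, 0 <= f x x.
Hypothesis f_eq0 : forall x, f x x = 0 -> x = 0.

Let fDr x y z : f x (y + z) = f x y + f x z.
Proof. by rewrite fC fDl !(fC x). Qed.

Let fZr a x y : f x (a *: y) = a * f x y.
Proof. by rewrite fC fZl (fC x). Qed.

Lemma cauchy_schwarz_form x y : f x y ^+ 2 <= f x x * f y y.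
Proof.
have [y0|yN0] := eqVneq (f y y) 0.
  have fy : f x y = 0.
    by rewrite (f_eq0 y0) -(scale0r (0 : V)) fZr mul0r.
  by rewrite fy y0 mulr0 expr0n.
have y_gt0 : 0 < f y y by rewrite lt_neqAle eq_sym yN0 f_ge0.
have := f_ge0 (f y y *: x + (- f x y) *: y).
rewrite fDl !fDr !fZl !fZr (fC y x) => h.
suff : 0 <= f y y * (f x x * f y y - f x y ^+ 2).
  by rewrite pmulr_rge0 // subr_ge0.
apply: le_trans h _; rewrite le_eqVlt; apply/orP; left; apply/eqP; ring.
Qed.

Lemma sqrt_form_triangle x y :
  Num.sqrt (f (x + y) (x + y)) <= Num.sqrt (f x x) + Num.sqrt (f y y).
Proof.
have s_ge0 : 0 <= Num.sqrt (f x x) + Num.sqrt (f y y).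
  by rewrite addr_ge0 // sqrtr_ge0.
rewrite -[leRHS](ger0_norm s_ge0) -sqrtr_sqr ler_sqrt ?sqr_ge0 //.
rewrite sqrrD !sqr_sqrtr // fDl !fDr (fC y x).
suff : f x y <= Num.sqrt (f x x) * Num.sqrt (f y y).
  by move=> h; rewrite mulr2n; lra.
rewrite -sqrtrM //; apply: le_trans (ler_norm _) _.
by rewrite -sqrtr_sqr ler_sqrt ?cauchy_schwarz_form // mulr_ge0.
Qed.

Lemma sqrt_formZ a x : Num.sqrt (f (a *: x) (a *: x)) = `|a| * Num.sqrt (f x x).
Proof. by rewrite fZl fZr mulrA -expr2 sqrtrM ?sqr_ge0 // sqrtr_sqr. Qed.

Lemma sqrt_form_eq0 x : Num.sqrt (f x x) = 0 -> x = 0.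
Proof.
move/eqP; rewrite sqrtr_eq0 => h; apply: f_eq0.
by apply/eqP; rewrite eq_le h f_ge0.
Qed.

End InnerProductNorm.

Definition symmetric_mx {R : realType} {n : nat} : {pred 'M[R]_n} :=
  fun A => A^T == A.

Fact symmetric_mx_submod_closed (R : realType) (n : nat) :
  GRing.submod_closed (@symmetric_mx R n).
Proof.
split=> [|a A B /eqP hA /eqP hB]; apply/eqP; first by rewrite trmx0.
by rewrite linearP /= hA hB.
Qed.

HB.instance Definition _ (R : realType) (n : nat) :=
  GRing.isSubmodClosed.Build R 'M[R]_n (@symmetric_mx R n)
    (@symmetric_mx_submod_closed R n).

Record symmx (R : realType) (n : nat) := SymMx {
  symmx_val :> 'M[R]_n;
  _ : symmx_val \in symmetric_mx
}.

Section SymmxHilbert.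
Context {R : realType} {n : nat}.
Local Notation S := (symmx R n).
Implicit Types A B C : S.

HB.instance Definition _ := [isSub for @symmx_val R n].
HB.instance Definition _ := [Choice of S by <:].
HB.instance Definition _ := [SubChoice_isSubLmodule of S by <:].

Lemma symmx_tr (A : S) : (A : 'M[R]_n)^T = A.
Proof. by case: A => A /= /eqP. Qed.

Definition symmx_inner (A B : S) : R := \tr ((A : 'M[R]_n) *m (B : 'M[R]_n)).

Lemma symmx_innerC A B : symmx_inner A B = symmx_inner B A.
Proof. exact: mxtrace_mulC. Qed.

Lemma symmx_innerDl A B C :
  symmx_inner (A + B) C = symmx_inner A C + symmx_inner B C.
Proof. by rewrite /symmx_inner mulmxDl mxtraceD. Qed.

Lemma symmx_innerZl a A B : symmx_inner (a *: A) B = a * symmx_inner A B.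
Proof. by rewrite /symmx_inner -scalemxAl mxtraceZ. Qed.

Lemma symmx_innerE A :
  symmx_inner A A = \sum_i \sum_j (A : 'M[R]_n) i j ^+ 2.
Proof.
rewrite /symmx_inner /mxtrace; apply: eq_bigr => i _.
rewrite mxE; apply: eq_bigr => j _.
by rewrite expr2 -{2}(symmx_tr A) mxE.
Qed.

Lemma symmx_inner_ge0 A : 0 <= symmx_inner A A.
Proof.
by rewrite symmx_innerE; do 2!apply: sumr_ge0 => ? _; exact: sqr_ge0.
Qed.

Lemma le_entry_symmx_inner A i j :
  (A : 'M[R]_n) i j ^+ 2 <= symmx_inner A A.
Proof.
rewrite symmx_innerE (bigD1 i) //= (bigD1 j) //= -addrA lerDl.
apply: addr_ge0; first by apply: sumr_ge0 => ? _; exact: sqr_ge0.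
by do 2!apply: sumr_ge0 => ? _; exact: sqr_ge0.
Qed.

Lemma symmx_inner_eq0 A : symmx_inner A A = 0 -> A = 0.
Proof.
move=> A0; apply/val_inj/matrixP => i j; rewrite [RHS]mxE; apply/eqP.
by rewrite -sqrf_eq0 eq_le sqr_ge0 andbT -A0 le_entry_symmx_inner.
Qed.

(* The topology of [symmx R n] comes from the norm of the trace inner product,
   not from the entrywise sup norm that MathComp-Analysis puts on ['M[R]_n]. *)
HB.instance Definition _ := @Lmodule_isNormed.Build R S
  (fun A => Num.sqrt (symmx_inner A A))
  (sqrt_form_triangle symmx_innerC symmx_innerDl symmx_innerZl
     symmx_inner_ge0 symmx_inner_eq0)
  (sqrt_formZ symmx_innerC symmx_innerZl)
  (sqrt_form_eq0 symmx_inner_ge0 symmx_inner_eq0).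

Lemma symmx_normE (A : S) : `|A| = Num.sqrt (symmx_inner A A).
Proof. by []. Qed.

Lemma le_entry_symmx_norm (A : S) i j : `|(A : 'M[R]_n) i j| <= `|A|.
Proof.
by rewrite symmx_normE -sqrtr_sqr ler_sqrt ?symmx_inner_ge0 //
  le_entry_symmx_inner.
Qed.

Lemma symmx_complete (F : set_system S) : ProperFilter F -> cauchy F -> cvg F.
Proof.
move=> FF /cauchy_ballP Fc.
have entry_cvg i j : cvg ((fun A : S => (A : 'M[R]_n) i j) @ F).
  apply: cauchy_cvg; apply/cauchy_ballP => e e0.
  have := Fc e e0; rewrite !near2E /=.
  case=> -[P Q] /= [FP FQ] PQ.
  exists ((fun A : S => (A : 'M[R]_n) i j) @` P,
          (fun A : S => (A : 'M[R]_n) i j) @` Q).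
    by split => /=; [move: FP|move: FQ]; apply: filterS => A ?; exists A.
  move=> [a b] /= [[A PA <-] [B QB <-]].
  have := PQ (A, B) (conj PA QB); rewrite /= -!ball_normE /=.
  by apply: le_lt_trans; have := le_entry_symmx_norm (A - B) i j; rewrite !mxE.
pose L := \matrix_(i, j) lim ((fun A : S => (A : 'M[R]_n) i j) @ F) : 'M[R]_n.
have Lsym : L \in symmetric_mx.
  apply/eqP/matrixP => i j; rewrite !mxE; congr (lim (fmap _ F)).
  by apply/funext => A; rewrite -{1}(symmx_tr A) mxE.
apply/cvg_ex; exists (SymMx Lsym); apply/cvgrPdist_lt => e e0.
have c : (fun A : S => \sum_i \sum_j (L i j - (A : 'M[R]_n) i j) ^+ 2) @ F
    --> \sum_(i < n) \sum_(j < n) (0 : R).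
  apply: cvg_big => [|i _]; first exact: add_continuous.
  apply: cvg_big => [|j _]; first exact: add_continuous.
  have d : (fun A : S => L i j - (A : 'M[R]_n) i j) @ F --> L i j - L i j.
    apply: cvgB; first exact: cvg_cst.
    by rewrite /L mxE; exact: entry_cvg i j.
  have -> : (0 : R) = (L i j - L i j) * (L i j - L i j) by rewrite subrr mul0r.
  by under eq_fun do rewrite expr2; exact: cvgM.
move: c; rewrite big1 => [|i _]; last by rewrite big1.
move=> /cvgrPdist_lt /(_ (e ^+ 2)); rewrite exprn_gt0 // => /(_ isT).
apply: filterS => A; rewrite sub0r normrN => h.
rewrite symmx_normE -(ger0_norm (ltW e0)) -sqrtr_sqr ltr_sqrt ?exprn_gt0 //.
rewrite symmx_innerE; apply: le_lt_trans h; apply: le_trans (ler_norm _).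
by apply: ler_sum => i _; apply: ler_sum => j _; rewrite !mxE.
Qed.

HB.instance Definition _ := Uniform_isComplete.Build S symmx_complete.

Lemma symmx_inner_normE (A : S) : symmx_inner A A = `|A| ^+ 2.
Proof. by rewrite symmx_normE sqr_sqrtr // symmx_inner_ge0. Qed.

HB.instance Definition _ := hasInner.Build R S
  symmx_innerC symmx_innerDl symmx_innerZl symmx_inner_normE.

End SymmxHilbert.

Definition psd_cone (R : realType) (n : nat) : set (symmx R n) :=
  [set A | forall v : 'cV[R]_n, 0 <= (v^T *m (A : 'M[R]_n) *m v) 0 0].
Arguments psd_cone R n : clear implicits.

(* Main.v *)
Require Import Defs.
From mathcomp Require Import all_boot all_order all_algebra.
From mathcomp Require Import all_classical all_reals all_analysis.
From mathcomp Require Import ring lra.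

Set Implicit Arguments.
Unset Strict Implicit.
Unset Printing Implicit Defensive.
Import Order.TTheory GRing.Theory Num.Theory.
Import numFieldNormedType.Exports.
Local Open Scope classical_set_scope.
Local Open Scope ring_scope.

(** Let C be the cone of positive semidefinite matrices and F one of its faces.
    A sum A + B of elements of F is in F and its kernel is the intersection of
    those of A and B, so a matrix A of F of maximal rank has a row space that
    contains the row spaces of all elements of F ([face_max_support]).

    Let W be the space of symmetric matrices X whose row space is contained in
    that of A. On W the quadratic form of X is dominated by that of A: for some
    K, |v^T X v| <= K |X| (v^T A v) for all v ([submx_bform_bound]). Indeed
    X = (G A)^T X (G A) for a partial inverse G of A, so that
    |v^T X v| <= |X| |G A v|^2, and the Cauchy-Schwarz inequality for the form
    of A bounds |G A v|^2 by tr(G A G^T) (v^T A v). This inequality has two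
    consequences. Every X in C and W lies below a multiple of A, hence in F,
    so F is the intersection of C and W ([face_submxE]). And every X in W close
    enough to A satisfies |v^T (A - X) v| <= v^T A v, hence is in C: thus A is
    interior to F relative to W, which contains the closed span of F.

    For the self-duality of F, the trace of a product of two positive
    semidefinite matrices is nonnegative ([mxtrace_mul_psdmx_ge0]), so F is
    contained in its dual. Conversely, let X in W be nonnegative on F. For every
    w the matrix (A w)(A w)^T is in F, and its inner product with X is
    (A w)^T X (A w). Since the range of A supplements its kernel,
    X = (A E)^T X (A E) for some E ([submx_congr_range]), so taking w = E v
    shows that v^T X v is nonnegative. *)

(** * Bilinear forms and positive semidefinite matrices *)

Section BilinearForm.
Context {R : realType} {n : nat}.
Implicit Types (A B : 'M[R]_n) (u v w : 'cV[R]_n).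

Definition bform A u v : R := (u^T *m A *m v) 0 0.

Lemma bformDl A u v w : bform A (u + v) w = bform A u w + bform A v w.
Proof. by rewrite /bform raddfD /= !mulmxDl mxE. Qed.

Lemma bformZl A a u v : bform A (a *: u) v = a * bform A u v.
Proof. by rewrite /bform linearZ /= -!scalemxAl mxE. Qed.

Lemma bformDr A u v w : bform A u (v + w) = bform A u v + bform A u w.
Proof. by rewrite /bform mulmxDr mxE. Qed.

Lemma bformZr A a u v : bform A u (a *: v) = a * bform A u v.
Proof. by rewrite /bform -scalemxAr mxE. Qed.

Lemma bformDmx A B u v : bform (A + B) u v = bform A u v + bform B u v.
Proof. by rewrite /bform mulmxDr mulmxDl mxE. Qed.

Lemma bformZmx A a u v : bform (a *: A) u v = a * bform A u v.
Proof. by rewrite /bform -scalemxAr -scalemxAl mxE. Qed.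

Lemma bformBmx A B u v : bform (A - B) u v = bform A u v - bform B u v.
Proof. by rewrite -scaleN1r bformDmx bformZmx mulN1r. Qed.

Lemma bform_congr A (P : 'M[R]_n) u v :
  bform (P^T *m A *m P) u v = bform A (P *m u) (P *m v).
Proof. by rewrite /bform trmx_mul !mulmxA. Qed.

Lemma bformC A u v : A^T = A -> bform A u v = bform A v u.
Proof.
move=> sA; have -> : bform A u v = ((u^T *m A *m v)^T) 0 0 by rewrite mxE.
by rewrite /bform !trmx_mul trmxK sA mulmxA.
Qed.

Lemma bform_delta A i j : bform A (delta_mx i 0) (delta_mx j 0) = A i j.
Proof. by rewrite /bform trmx_delta -rowE -colE !mxE. Qed.

Lemma bform_deltal A i v : bform A (delta_mx i 0) v = (A *m v) i 0.
Proof. by rewrite /bform trmx_delta -mulmxA -rowE mxE. Qed.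

Lemma bform_outer w u : bform (w *m w^T) u u = ((w^T *m u) 0 0) ^+ 2.
Proof.
have uw : (u^T *m w) 0 0 = (w^T *m u) 0 0.
  by rewrite -[in LHS](trmxK w) -trmx_mul mxE.
by rewrite /bform mulmxA -mulmxA mxE big_ord1 uw expr2.
Qed.

Lemma mxtrace_mul_outer A w : \tr (A *m (w *m w^T)) = bform A w w.
Proof. by rewrite mulmxA mxtrace_mulC mulmxA trace_mx11. Qed.

Definition psdmx A := A^T = A /\ forall v, 0 <= bform A v v.

Lemma psdmx_outer w : psdmx (w *m w^T).
Proof.
split; first by rewrite trmx_mul trmxK.
by move=> v; rewrite bform_outer sqr_ge0.
Qed.

(** The form may be degenerate, so the usual argument, which divides by
    [bform A v v], covers only the case where one of the two vectors is not
    isotropic. *)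
Lemma psdmx_cauchy_schwarz A u v : psdmx A ->
  bform A u v ^+ 2 <= bform A u u * bform A v v.
Proof.
move=> [sA pA].
have h a b : 0 <= a ^+ 2 * bform A u u + 2 * (a * b * bform A u v)
                  + b ^+ 2 * bform A v v.
  have := pA (a *: u + b *: v).
  rewrite bformDl !bformDr !bformZl !bformZr (bformC v u sA).
  by congr (_ <= _); ring.
have [v0|vN0] := eqVneq (bform A v v) 0.
  have [u0|uN0] := eqVneq (bform A u u) 0.
    (* For isotropic u and v, the value at u - bform A u v *: v is
       -2 (bform A u v)^2. *)
    by have := h 1 (- bform A u v); rewrite u0 v0; nra.
  have u_gt0 : 0 < bform A u u by rewrite lt_neqAle eq_sym uN0 pA.
  have := h (- bform A u v) (bform A u u); rewrite v0.
  by rewrite !mulr0 => h1; rewrite -(ler_pM2l u_gt0); nra.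
have v_gt0 : 0 < bform A v v by rewrite lt_neqAle eq_sym vN0 pA.
rewrite -(ler_pM2l v_gt0) -subr_ge0.
have := h (bform A v v) (- bform A u v); congr (_ <= _); ring.
Qed.

Lemma psdmx_kernel A v : psdmx A -> bform A v v = 0 -> A *m v = 0.
Proof.
move=> pA v0; apply/colP => i; rewrite -bform_deltal mxE; apply/eqP.
have := psdmx_cauchy_schwarz (delta_mx i 0) v pA.
by rewrite v0 mulr0 -sqrf_eq0 eq_le sqr_ge0 andbT.
Qed.

Lemma psdmx_eq0 A : psdmx A -> (forall v, bform A v v = 0) -> A = 0.
Proof.
move=> pA A0; apply/matrixP => i j.
by rewrite -bform_delta bform_deltal psdmx_kernel // !mxE.
Qed.

(** Peel rank-one terms off B, as in the Cholesky factorization: if [B i i] is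
    positive and b is the i-th column of B, Cauchy-Schwarz says that the Schur
    complement B - b b^T / [B i i] is still positive semidefinite, while the
    term removed contributes b^T A b / [B i i] to the trace. The process stops
    because the number of nonzero diagonal entries decreases: a zero diagonal
    entry of B forces a zero column, so it stays zero, and entry i vanishes. *)
Lemma mxtrace_mul_psdmx_ge0 A B : psdmx A -> psdmx B -> 0 <= \tr (A *m B).
Proof.
move=> pA.
have [k] := ubnP #|[pred i | B i i != 0]|.
elim: k B => [|k IHk] B; first by rewrite ltn0.
move=> Bk pB.
have [i Bi|Bi] := pickP (fun i => B i i != 0); last first.
  suff -> : B = 0 by rewrite mulmx0 mxtrace0.
  apply/matrixP => i j; have /negbFE/eqP Bjj := Bi j.
  by rewrite -bform_delta bform_deltal psdmx_kernel ?bform_delta // !mxE.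
have Bi_gt0 : 0 < B i i by rewrite lt_neqAle eq_sym Bi -bform_delta pB.2.
pose b := B *m delta_mx i 0 : 'cV[R]_n.
have Eb v : (b^T *m v) 0 0 = bform B (delta_mx i 0) v.
  by rewrite /b trmx_mul pB.1.
pose B' := B + (- (B i i)^-1) *: (b *m b^T).
have BE : B = B' + (B i i)^-1 *: (b *m b^T).
  by rewrite /B' -addrA -scalerDl addNr scale0r addr0.
have B'v v : bform B' v v =
    bform B v v - (B i i)^-1 * bform B (delta_mx i 0) v ^+ 2.
  by rewrite bformDmx bformZmx bform_outer Eb mulNr.
have pB' : psdmx B'.
  split=> [|v].
    by rewrite /B' linearD linearZ /= trmx_mul trmxK pB.1.
  rewrite B'v subr_ge0 mulrC ler_pdivrMr // mulrC -bform_delta.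
  exact: psdmx_cauchy_schwarz.
rewrite BE mulmxDr mxtraceD -scalemxAr mxtraceZ mxtrace_mul_outer.
rewrite addr_ge0 ?mulr_ge0 ?invr_ge0 ?(ltW Bi_gt0) ?pA.2 //.
apply: IHk pB'; rewrite -ltnS; apply: leq_trans Bk; rewrite ltnS.
apply/proper_card/properP; split.
  apply/fintype.subsetP => j; rewrite !inE; apply: contraNneq => Bj.
  have Bij : bform B (delta_mx i 0) (delta_mx j 0) = 0.
    by rewrite bform_deltal psdmx_kernel ?bform_delta // mxE.
  by rewrite -bform_delta B'v Bij expr0n mulr0 subr0 bform_delta Bj.
exists i; rewrite !inE // negbK -bform_delta B'v bform_delta.
by rewrite expr2 mulKf // subrr.
Qed.

(** * Row spaces of positive semidefinite matrices *)

(** If (A + B) v = 0, then the nonnegative numbers v^T A v and v^T B v add up to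
    zero, so A v = 0. Applied to the columns of a cokernel of A + B, this gives
    the inclusion of row spaces. The sum is delimited because [+] in matrix
    space scope is the sum of row spaces. *)
Lemma psdmx_submx_add A B : psdmx A -> psdmx B -> (A <= (A + B)%R)%MS.
Proof.
move=> pA pB; rewrite submxE; apply/eqP/matrixP => i j.
set C := cokermx _; pose v : 'cV_n := C *m delta_mx j 0.
have ABv : (A + B) *m v = 0 by rewrite /v mulmxA mulmx_coker mul0mx.
have s0 : bform A v v + bform B v v = 0.
  by rewrite -bformDmx /bform -mulmxA ABv mulmx0 mxE.
have A0 : bform A v v = 0.
  have := pA.2 v; have := pB.2 v; lra.
by have /colP/(_ i) := psdmx_kernel pA A0; rewrite mulmxA -colE !mxE.
Qed.

(** If A A v = 0 then |A v|^2 = v^T A A v = 0. *)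
Lemma symmetric_submx_sqr A : A^T = A -> (A <= A *m A)%MS.
Proof.
move=> sA; rewrite submxE; set C := cokermx _; apply/eqP/matrixP => i j.
have AC : A *m A *m C = 0 by rewrite /C mulmx_coker.
have : (((A *m C)^T *m (A *m C)) j j) = 0.
  by rewrite trmx_mul sA -mulmxA [A *m (A *m C)]mulmxA AC mulmx0 mxE.
rewrite !mxE => /eqP; rewrite psumr_eq0 => [/allP /(_ i)|k _].
  by rewrite mem_index_enum !mxE -expr2 sqrf_eq0 => /(_ isT)/eqP.
by rewrite !mxE -expr2 sqr_ge0.
Qed.

(** [pinvmx A *m A] acts as the identity, by right multiplication, on the row
    space of A; transposing gives the same for the columns of B. *)
Lemma submx_congr_pinv A B : A^T = A -> B^T = B -> (B <= A)%MS ->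
  B = (pinvmx A *m A)^T *m B *m (pinvmx A *m A).
Proof.
move=> sA sB BA.
have E : B *m (pinvmx A *m A) = B by rewrite mulmxA mulmxKpV.
by rewrite -mulmxA E -[LHS]sB -[in LHS]E trmx_mul sB.
Qed.

(** Unlike in [submx_congr_pinv], the congruence is by a matrix whose range lies
    in that of A; this relies on the kernel and the range of A being
    supplementary, which comes from [symmetric_submx_sqr]. *)
Lemma submx_congr_range A B : A^T = A -> B^T = B -> (B <= A)%MS ->
  exists E, B = (A *m E)^T *m B *m (A *m E).
Proof.
move=> sA sB BA; have /submxP[D AD] := symmetric_submx_sqr sA.
have AE : A *m A *m D^T = A.
  by rewrite -[RHS]sA [in RHS]AD !trmx_mul sA.
exists D^T; have /submxP[Z BZ] := BA.
have E : B *m (A *m D^T) = B.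
  by rewrite BZ -mulmxA [A *m (A *m _)]mulmxA AE.
by rewrite -mulmxA E -[LHS]sB -[in LHS]E trmx_mul sB.
Qed.

(** The i-th coordinate of G A v is the value of the form A at v and the i-th
    row of G: apply Cauchy-Schwarz to each and sum. *)
Lemma psdmx_image_bound A (G : 'M[R]_n) v : psdmx A ->
  ((G *m A *m v)^T *m (G *m A *m v)) 0 0 <= \tr (G *m A *m G^T) * bform A v v.
Proof.
move=> pA; rewrite mxE /mxtrace mulr_suml; apply: ler_sum => i _.
have -> : (G *m A *m G^T) i i = bform A (row i G)^T (row i G)^T.
  rewrite /bform trmxK -row_mul !mxE; apply: eq_bigr => j _.
  by rewrite !mxE.
rewrite mxE -expr2.
have -> : (G *m A *m v) i 0 = bform A (row i G)^T v.
  by rewrite /bform trmxK -!row_mul [RHS]mxE.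
exact: psdmx_cauchy_schwarz.
Qed.

End BilinearForm.

(** * Topology of the space of symmetric matrices *)

Lemma inner_le_norm (R : realType) (H : hilbertType R) (x y : H) :
  `|inner x y| <= `|x| * `|y|.
Proof.
have inner_ge0 (z : H) : 0 <= inner z z by rewrite inner_normE sqr_ge0.
have inner_eq0 (z : H) : inner z z = 0 -> z = 0.
  by rewrite inner_normE => /eqP; rewrite sqrf_eq0 normr_eq0 => /eqP.
have := cauchy_schwarz_form (@innerC R H) (@innerDl R H) (@innerZl R H)
  inner_ge0 inner_eq0 x y.
rewrite !inner_normE -exprMn -[leLHS]real_normK ?num_real //.
by rewrite ler_sqr // nnegrE mulr_ge0.
Qed.

Section SymmetricMatrices.
Context {R : realType} {n : nat}.
Local Notation S := (symmx R n).
Implicit Types (A B X : S) (F : set S).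

Lemma psd_coneP A : psd_cone R n A <-> psdmx (A : 'M[R]_n).
Proof. by split=> [pA|[]//]; split=> //; exact: symmx_tr. Qed.

Lemma outer_symmetric (w : 'cV[R]_n) : w *m w^T \in symmetric_mx.
Proof. by apply/eqP; case: (psdmx_outer w). Qed.

Definition outer_symmx w : S := SymMx (outer_symmetric w).

Lemma inner_outer_symmx A w : inner A (outer_symmx w) = bform A w w.
Proof. exact: mxtrace_mul_outer. Qed.

Lemma norm_outer_symmx w : `|outer_symmx w| = (w^T *m w) 0 0.
Proof.
have ww : 0 <= (w^T *m w) 0 0.
  by rewrite mxE; apply: sumr_ge0 => i _; rewrite mxE -expr2 sqr_ge0.
apply/eqP; rewrite -(@eqrXn2 _ 2) //; apply/eqP.
by rewrite -inner_normE inner_outer_symmx bform_outer.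
Qed.

(** The quadratic form of A at w is the inner product of A with w w^T, whose
    norm is |w|^2. *)
Lemma bform_le_norm A w : `|bform A w w| <= `|A| * (w^T *m w) 0 0.
Proof. by rewrite -inner_outer_symmx -norm_outer_symmx inner_le_norm. Qed.

Lemma cvg_symmx_mul (G : set_system S) (FG : Filter G) X p
    (C : 'M[R]_(n, p)) i j : G --> X ->
  (fun Y : S => ((Y : 'M[R]_n) *m C) i j) @ G --> ((X : 'M[R]_n) *m C) i j.
Proof.
move=> GX; rewrite mxE; under eq_fun do rewrite mxE.
apply: cvg_big => [|k _]; first exact: add_continuous.
apply: cvgM; last exact: cvg_cst.
apply/cvgrPdist_lt => e e0; move/cvgrPdist_lt: GX => /(_ e e0).
apply: filterS => Y; apply: le_lt_trans.
by have := le_entry_symmx_norm (X - Y) i k; rewrite !mxE.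
Qed.

Lemma cvg_bform (G : set_system S) (FG : Filter G) X v : G --> X ->
  (fun Y : S => bform Y v v) @ G --> bform X v v.
Proof.
have E (Y : S) : bform Y v v = \sum_k v k 0 * ((Y : 'M[R]_n) *m v) k 0.
  by rewrite /bform -mulmxA mxE; apply: eq_bigr => k _; rewrite mxE.
move=> GX; rewrite E; under eq_fun do rewrite E.
apply: cvg_big => [|k _]; first exact: add_continuous.
by apply: cvgM; [exact: cvg_cst|exact: cvg_symmx_mul].
Qed.

Lemma closed_psd_cone : closed (psd_cone R n).
Proof.
have -> : psd_cone R n =
    \bigcap_v ((fun X : S => bform X v v) @^-1` [set x | 0 <= x]).
  by apply/seteqP; split=> [X pX v _|X pX v]; [exact: pX|exact: pX].
apply: closed_bigI => v _; apply: closed_comp; last exact: closed_ge.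
by move=> X _; exact: (cvg_bform (nbhs_filter X) (@cvg_id _ (nbhs X))).
Qed.

Lemma closed_submx A : closed [set X : S | ((X : 'M[R]_n) <= (A : 'M[R]_n))%MS].
Proof.
have -> : [set X : S | ((X : 'M[R]_n) <= (A : 'M[R]_n))%MS] = \bigcap_ij
    ((fun X : S => ((X : 'M[R]_n) *m cokermx A) ij.1 ij.2) @^-1` [set 0]).
  apply/seteqP; split=> [X /= XA ij _ /=|X /= XA].
    by move: XA; rewrite submxE => /eqP ->; rewrite mxE.
  by rewrite submxE; apply/eqP/matrixP => i j; rewrite (XA (i, j)) // mxE.
apply: closed_bigI => ij _; apply: closed_comp; last exact: closed_eq.
move=> X _.
exact: (cvg_symmx_mul (nbhs_filter X) (@cvg_id _ (nbhs X))).
Qed.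

Lemma linear_subspace_submx A :
  linear_subspace [set X : S | ((X : 'M[R]_n) <= (A : 'M[R]_n))%MS].
Proof.
split=> [|a b X Y XA YA] /=; first exact: sub0mx.
exact: addmx_sub (scalemx_sub a XA) (scalemx_sub b YA).
Qed.

(** * The cone of positive semidefinite matrices and its faces *)

Lemma cone_psd_cone : cone (psd_cone R n).
Proof.
split=> [v|a b X Y a0 b0 XC YC v]; first by rewrite mulmx0 mul0mx mxE.
change (0 <= bform (a *: (X : 'M[R]_n) + b *: (Y : 'M[R]_n)) v v).
rewrite bformDmx !bformZmx.
by apply: addr_ge0; apply: mulr_ge0 => //; [exact: XC|exact: YC].
Qed.

Lemma pointed_psd_cone : pointed_cone (psd_cone R n).
Proof.
apply/seteqP; split=> [X [XC [Y YC YX]]|_ ->]; last first.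
  have [C0 _] := cone_psd_cone.
  by split => //; exists 0; rewrite ?oppr0.
apply/val_inj/psdmx_eq0; first exact/psd_coneP.
move=> v; apply/eqP; rewrite eq_le (XC v) andbT -YX.
change (bform (- (Y : 'M[R]_n)) v v <= 0).
by rewrite -scaleN1r bformZmx mulN1r oppr_le0; exact: YC.
Qed.

(** The form of A is bounded below, up to a constant, by the square of the norm
    of G A v with G a partial inverse of A, and X only sees v through G A v. *)
Lemma submx_bform_bound A : psdmx (A : 'M[R]_n) -> exists2 K, 0 < K &
  forall X v, ((X : 'M[R]_n) <= (A : 'M[R]_n))%MS ->
  `|bform X v v| <= `|X| * K * bform A v v.
Proof.
move=> pA; set G := pinvmx (A : 'M[R]_n).
have t_ge0 : 0 <= \tr (G *m A *m G^T).
  apply: sumr_ge0 => i _; rewrite -bform_delta.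
  have := pA.2 (G^T *m delta_mx i 0).
  by rewrite -bform_congr trmxK.
(* The trace vanishes when A does; adding 1 keeps the constant positive. *)
exists (\tr (G *m A *m G^T) + 1) => [|X v XA]; first by rewrite ltr_wpDl.
rewrite (submx_congr_pinv (symmx_tr A) (symmx_tr X) XA) bform_congr.
apply: le_trans (bform_le_norm _ _) _.
rewrite -mulrA ler_wpM2l //; apply: le_trans (psdmx_image_bound _ _ pA) _.
by rewrite ler_wpM2r ?pA.2 // lerDl.
Qed.

(** A matrix of maximal rank in F: adding another element of F cannot enlarge
    its row space. *)
Lemma face_max_support F : face (psd_cone R n) F ->
  exists2 A, F A & forall B, F B -> ((B : 'M[R]_n) <= (A : 'M[R]_n))%MS.
Proof.
move=> [FC [F0 FD] _].
pose P k := `[< exists2 A, F A & \rank (A : 'M[R]_n) = k >].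
have exP : exists k, P k.
  by exists (\rank (0 : 'M[R]_n)); apply/asboolP; exists 0.
have leP k : P k -> (k <= n)%N by move=> /asboolP[A _ <-]; exact: rank_leq_row.
have [k /asboolP[A FA Ak] maxA] := ex_maxnP exP leP.
exists A => // B FB.
have FAB : F (A + B) by rewrite -[A]scale1r -[B]scale1r; exact: FD.
have pA : psdmx (A : 'M[R]_n) by exact/psd_coneP/FC.
have pB : psdmx (B : 'M[R]_n) by exact/psd_coneP/FC.
have sA := psdmx_submx_add pA pB.
have ABA : (((A : 'M[R]_n) + (B : 'M[R]_n))%R <= (A : 'M[R]_n))%MS.
  rewrite -(geq_leqif (mxrank_leqif_sup sA)) Ak.
  by apply: maxA; apply/asboolP; exists (A + B).
rewrite -[X in (X <= _)%MS](addKr (A : 'M[R]_n)) addmx_sub //.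
by rewrite eqmx_opp.
Qed.

(** A positive semidefinite X with row space in that of A is below c A for c
    large enough, by [submx_bform_bound], and a face is downward closed. *)
Lemma face_submxE F A : face (psd_cone R n) F -> F A ->
  (forall B, F B -> ((B : 'M[R]_n) <= (A : 'M[R]_n))%MS) ->
  F = psd_cone R n `&` [set X : S | ((X : 'M[R]_n) <= (A : 'M[R]_n))%MS].
Proof.
move=> [FC [F0 FD] Fdown] FA FleA; apply/seteqP; split=> [X FX|X [XC XA]].
  by split; [exact: FC|exact: FleA].
have pA : psdmx (A : 'M[R]_n) by exact/psd_coneP/FC.
have [K K_gt0 bound] := submx_bform_bound pA.
pose c := `|X| * K + 1.
have c_gt0 : 0 < c by rewrite ltr_wpDl // mulr_ge0 // ltW.
have FcA : F (c *: A).
  by rewrite -[_ *: A]addr0 -(scale0r A); apply: FD => //; exact: ltW.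
apply: (Fdown X (c *: A)) => //; rewrite /cone_le ?subr0 // => v.
change (0 <= bform (c *: (A : 'M[R]_n) - (X : 'M[R]_n)) v v).
rewrite bformBmx bformZmx subr_ge0.
apply: le_trans (ler_norm _) _; apply: le_trans (bound _ v XA) _.
by rewrite ler_wpM2r ?pA.2 // lerDl.
Qed.

End SymmetricMatrices.

Theorem proposition5p1 (R : realType) (n : nat) (n_gt0 : (0 < n)%N) :
  perfect_cone (psd_cone R n).
Proof.
split; [exact: cone_psd_cone|exact: closed_psd_cone|exact: pointed_psd_cone|].
move=> F faceF; have [A FA FleA] := face_max_support faceF.
have FE := face_submxE faceF FA FleA.
have pA : psdmx (A : 'M[R]_n).
  by apply/psd_coneP; case: faceF => FC _ _; exact: FC.
have F_span : F `<=` closed_span F.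
  by apply: subset_trans (@subset_closure _ _); exact: sub_gen_smallest.
have span_A X : closed_span F X -> ((X : 'M[R]_n) <= (A : 'M[R]_n))%MS.
  move=> FX.
  suff : closure [set Y : symmx R n |
      ((Y : 'M[R]_n) <= (A : 'M[R]_n))%MS] X.
    by rewrite -(closure_id _).1 //; exact: closed_submx.
  move: FX; apply: closure_subset; apply: smallest_sub; last exact: FleA.
  exact: linear_subspace_submx.
split.
  apply/seteqP; split=> [X [/span_A XA X_ge0]|X FX]; last first.
    split=> [|Y FY]; first exact: F_span.
    move: FX FY; rewrite FE => -[/psd_coneP pX _] [/psd_coneP pY _].
    exact: mxtrace_mul_psdmx_ge0.
  rewrite FE; split=> // v; rewrite -/(bform _ _ _).
  have [E ->] := submx_congr_range (symmx_tr A) (symmx_tr X) XA.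
  rewrite bform_congr -inner_outer_symmx; apply: X_ge0; rewrite FE.
  split; first by apply/psd_coneP/psdmx_outer.
  rewrite /= trmx_mul trmx_mul symmx_tr !mulmxA; exact: submxMl.
have [K K_gt0 bound] := submx_bform_bound pA.
exists A; rewrite /relative_interior /interior.
have A_span : closed_span F A by exact: F_span.
suff : within (closed_span F) (nbhs A) F by rewrite (nbhs_subspace_in A_span).
have nearA : nbhs A (fun X : symmx R n => `|A - X| < K^-1).
  by apply: cvgr_dist_lt (@cvg_id _ (nbhs A)) _ _; rewrite invr_gt0.
apply: filterS nearA => X nearX spanX; rewrite FE; split; last exact: span_A.
move=> v; rewrite -/(bform _ _ _).
have XA : `|A - X| * K <= 1 by rewrite -ler_pdivlMr // mul1r ltW.
have AXA : (((A - X : symmx R n) : 'M[R]_n) <= (A : 'M[R]_n))%MS.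
  by apply: addmx_sub; rewrite // eqmx_opp span_A.
have := bound _ v AXA; have := ler_wpM2r (pA.2 v) XA.
rewrite mul1r => h1 h2; have := le_trans (le_trans (ler_norm _) h2) h1.
change (bform ((A : 'M[R]_n) - (X : 'M[R]_n)) v v <= bform A v v ->
        0 <= bform X v v).
by rewrite bformBmx gerBl.
Qed.
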